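(* Let $D_1$ and $D_2$ be knot diagrams such that $D_1$ can be obtained from $D_2$ by changing exactly one under-crossing to an over-crossing or one over-crossing to an under-crossing. If there exists a real rational knot of degree $d$ with diagram $D_1$, then there exists a real rational knot of degree $d+2$ with diagram $D_2$.
   Context: A real rational knot of degree $d$ is a knot in $\mathbb{RP}^3$ parametrized by a map $\mathbb{RP}^1\to\mathbb{RP}^3$, $[s:t]\mapsto[p_0(s,t):p_1(s,t):p_2(s,t):p_3(s,t)]$, with $p_0,\dots,p_3$ real homogeneous polynomials all of degree $d$. A diagram of a knot in $\mathbb{RP}^3$ is its image under a generic projection from a point of $\mathbb{RP}^3$ not on the knot to $\mathbb{RP}^2$, together with over/under-crossing information at the double points. *)

(* Defs.v *)
From HB Require Import structures.
From mathcomp Require Import all_boot all_order all_algebra.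
From mathcomp Require Import all_classical all_reals all_analysis.
From mathcomp Require mpoly.

Set Implicit Arguments.
Unset Strict Implicit.
Unset Printing Implicit Defensive.

Import Order.TTheory GRing.Theory Num.Theory.
Import numFieldNormedType.Exports.

Local Open Scope classical_set_scope.
Local Open Scope ring_scope.

(* Conventions.
   - A point of RP^n is the line spanned by a nonzero row vector of length n+1;
     (_ == _)%MS compares spans.
   - RP^1 is R modulo pi, the angle x standing for [cos x : sin x]. A closed
     curve in RP^n is a function from R to nonzero row vectors whose class is
     pi-periodic. Every smooth map RP^1 -> RP^n has a smooth lift of this kind
     (it changes sign over a period if the curve is not null-homotopic). *)

Definition same_point (R : realType) (n : nat) (u v : 'rV[R]_n) : Prop :=
  (u == v)%MS.

Definition same_param (R : realType) (x y : R) : Prop :=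
  exists k : int, y = x + k%:~R * pi.

Definition smooth (R : realType) (n : nat) (f : R -> 'rV[R]_n.+1) : Prop :=
  forall (k : nat) (x : R), derivable (derive1n k f) x 1.

(* The class of f in projective space is an immersion at x iff f x and its
   derivative are linearly independent; this does not depend on the lift. *)
Definition immersed_curve (R : realType) (n : nat) (f : R -> 'rV[R]_n.+1) :
    Prop :=
  [/\ smooth f,
      forall x, f x != 0,
      forall x, same_point (f (x + pi)) (f x) &
      forall x, \rank (col_mx (f x) (derive1 f x)) = 2%N].

Definition knot (R : realType) (f : R -> 'rV[R]_4) : Prop :=
  immersed_curve f /\
  forall x y, same_point (f x) (f y) -> same_param x y.

(* [s : t] |-> [p_0(s,t) : p_1(s,t) : p_2(s,t) : p_3(s,t)] *)
Definition homog_map (R : realType) (d : nat) (p : 'I_4 -> mpoly.dhomog 2 R d)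
    (s t : R) : 'rV[R]_4 :=
  \row_j mpoly.meval (fun i : 'I_2 => if i == ord0 then s else t)
                     (mpoly.mpoly_of_dhomog (p j)).

(* The zero polynomial is homogeneous of every degree, so some p_j may vanish
   identically; that the p_j have no common real zero is part of knot. *)
Definition rational_knot (R : realType) (d : nat) (f : R -> 'rV[R]_4) : Prop :=
  knot f /\
  exists p : 'I_4 -> mpoly.dhomog 2 R d,
    forall x, f x = homog_map p (cos x) (sin x).

(* A knot diagram: the image curve in RP^2, and the crossing information.
   The set shadow consists of all nonzero vectors representing its points.
   The fibre over [v] of the projection RP^3 \ {center} -> RP^2 is an affine
   line; choosing v rather than -v orients it, and no choice is globally
   consistent. So goes_over v w reads: the strand through the double point [v]
   whose tangent is the projective line through [v] and [w] is the higher of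
   the two strands there, for the orientation of the fibre given by v.
   Diagrams are compared on the nose, not up to isotopy of RP^2; changing a
   crossing commutes with such isotopies. *)
Record diagram (R : realType) := Diagram {
  shadow : set 'rV[R]_3;
  goes_over : 'rV[R]_3 -> 'rV[R]_3 -> Prop
}.

(* Reversing the orientation of the fibre exchanges the higher strand and the
   lower one. *)
Definition goes_under (R : realType) (D : diagram R) (v w : 'rV[R]_3) : Prop :=
  goes_over D (- v) w.

(* Only transverse double points, finitely many of them. *)
Definition generic (R : realType) (g : R -> 'rV[R]_3) : Prop :=
  [/\ immersed_curve g,
      finite_set [set x : R | 0 <= x < pi /\
        exists y, ~ same_param x y /\ same_point (g x) (g y)],
      forall x y z, same_point (g x) (g y) -> same_point (g x) (g z) ->
        [\/ same_param x y, same_param x z | same_param y z] &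
      forall x y, ~ same_param x y -> same_point (g x) (g y) ->
        \rank (col_mx (g x) (col_mx (derive1 g x) (derive1 g y))) = 3%N].

(* The projection is u |-> u *m L; its center is the kernel of L. The point
   [u] = [u *m L : u *m h] lies at height (u *m h) 0 0 in the fibre over
   [u *m L], the fibre being oriented by the vector u *m L. *)
Definition projection (R : realType) (f : R -> 'rV[R]_4) (L : 'M[R]_(4, 3)) :
    R -> 'rV[R]_3 :=
  fun x => f x *m L.

Definition projection_diagram (R : realType) (f : R -> 'rV[R]_4)
    (L : 'M[R]_(4, 3)) (h : 'cV[R]_4) : diagram R :=
  let g := projection f L in
  {| shadow := [set v | v != 0 /\ exists x, same_point v (g x)];
     goes_over := fun v w => exists x y a b : R,
       [/\ v != 0 /\ ~ same_param x y,
           v = a *: g x,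
           v = b *: g y,
           (col_mx v w == col_mx (g x) (derive1 g x))%MS &
           b * (f y *m h) 0 0 < a * (f x *m h) 0 0] |}.

(* The positive determinant ties the orientation of the fibres to a fixed
   orientation of RP^3; a negative one would yield diagrams of the mirror
   image of f. Any two h with positive determinant give the same diagram.
   That the center is not on the knot is part of generic, as projection f L
   must not vanish. *)
Definition has_diagram (R : realType) (f : R -> 'rV[R]_4) (D : diagram R) :
    Prop :=
  exists (L : 'M[R]_(4, 3)) (h : 'cV[R]_4),
    [/\ 0 < \det (row_mx L h : 'M[R]_4),
        generic (projection f L) &
        D = projection_diagram f L h].

Definition knot_diagram (R : realType) (D : diagram R) : Prop :=
  exists f : R -> 'rV[R]_4, knot f /\ has_diagram f D.

(* D1 is obtained from D2 by exchanging the two strands at the crossing [c]. *)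
Definition crossing_change (R : realType) (D1 D2 : diagram R) : Prop :=
  exists c : 'rV[R]_3,
    [/\ exists w, goes_over D2 c w,
        shadow D1 = shadow D2,
        forall v w, same_point v c -> (goes_over D1 v w <-> goes_under D2 v w) &
        forall v w, ~ same_point v c -> (goes_over D1 v w <-> goes_over D2 v w)].

(* Main.v *)
(* Let the knot f of degree d project to g with heights eta, and let
   [g x0] = [g y0] be the crossing to be changed. For e > 0 the degree 2 form
   q = sin^2 (x - x0) + e is positive, and F = q f + e c cos^(d+2) (x - x0) w,
   where w spans the center of the projection and has height 1, has degree d + 2.
   The projection of F is q g, the same curve in RP^2, while the height becomes
     eta + e c cos^(d+2) (x - x0) / (sin^2 (x - x0) + e):
   eta plus a bump which equals c at x0 and tends to 0 with e at every other
   parameter. A suitable c reverses the crossing at x0, and as there are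
   finitely many double points, all other crossings are unchanged for small e.
   The strands still have different heights at every double point, so F is a
   knot. *)
Require Import Defs.
From mathcomp Require Import all_boot all_order all_algebra.
From mathcomp Require Import all_classical all_reals all_analysis.
From mathcomp Require Import zify ring lra.
From mathcomp Require Import -(notations) mpoly.

Set Implicit Arguments.
Unset Strict Implicit.
Unset Printing Implicit Defensive.

Import Order.TTheory GRing.Theory Num.Theory.
Import numFieldNormedType.Exports.

Local Open Scope classical_set_scope.
Local Open Scope ring_scope.

(** * Smooth functions and smooth curves *)

Definition smooth_fun (R : realType) (u : R -> R) : Prop :=
  forall (k : nat) (x : R), derivable (derive1n k u) x 1.

(** Recursing on the derivative of [u] lets a differentiation rule be applied once to [u] and then
    iterated by induction on the order, whereas [derive1n] has the last derivative outermost. The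
    order is off by one: [derivable_upto k u] provides k + 1 derivatives. *)
Fixpoint derivable_upto (R : realType) (k : nat) (u : R -> R) : Prop :=
  (forall x, derivable u x 1) /\
  (if k is k'.+1 then derivable_upto k' (derive1 u) else True).

Lemma smooth_fun_derivable_upto (R : realType) (u : R -> R) :
  smooth_fun u <-> forall k, derivable_upto k u.
Proof.
split=> [su k|du k].
  elim: k u su => [|k IHk] u su; split=> //; try by move=> x; exact: (su 0%N x).
  by apply: IHk => j x; rewrite -derive1Sn; exact: su.
elim: k u du => [|k IHk] u du x; first by have [] := du 0%N.
by rewrite derive1Sn; apply: IHk => j; have [] := du j.+1.
Qed.

Lemma derivable_uptoS (R : realType) (k : nat) (u : R -> R) :
  derivable_upto k.+1 u -> derivable_upto k u.
Proof.
elim: k u => [|k IHk] u [du du']; first by split.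
by split=> //; exact: IHk.
Qed.

Lemma derivable_uptoD (R : realType) (k : nat) (u w : R -> R) :
  derivable_upto k u -> derivable_upto k w ->
  derivable_upto k (fun x => u x + w x).
Proof.
elim: k u w => [|k IHk] u w [du du'] [dw dw'].
  by split=> [x|]; [exact: derivableD|exact: I].
split=> [x|]; first exact: derivableD.
have -> : derive1 (fun x => u x + w x) = (fun x => derive1 u x + derive1 w x).
  by apply/funext => x; rewrite !derive1E deriveD.
exact: IHk.
Qed.

Lemma derivable_uptoM (R : realType) (k : nat) (u w : R -> R) :
  derivable_upto k u -> derivable_upto k w ->
  derivable_upto k (fun x => u x * w x).
Proof.
elim: k u w => [|k IHk] u w Du Dw; have [du du'] := Du; have [dw dw'] := Dw.
  by split=> [x|]; [exact: derivableM|exact: I].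
split=> [x|]; first exact: derivableM.
have -> : derive1 (fun x => u x * w x) =
    (fun x => u x * derive1 w x + w x * derive1 u x).
  by apply/funext => x; rewrite !derive1E deriveM.
by apply: derivable_uptoD; apply: IHk => //; exact: derivable_uptoS.
Qed.

Lemma smooth_funD (R : realType) (u w : R -> R) :
  smooth_fun u -> smooth_fun w -> smooth_fun (fun x => u x + w x).
Proof.
rewrite !smooth_fun_derivable_upto => su sw k.
exact: derivable_uptoD.
Qed.

Lemma smooth_funM (R : realType) (u w : R -> R) :
  smooth_fun u -> smooth_fun w -> smooth_fun (fun x => u x * w x).
Proof.
rewrite !smooth_fun_derivable_upto => su sw k.
exact: derivable_uptoM.
Qed.

Lemma smooth_fun_cst (R : realType) (c : R) : smooth_fun (fun=> c).
Proof.
apply/smooth_fun_derivable_upto => k.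
elim: k c => [|k IHk] c; split=> //; try (by move=> x; exact: derivable_cst).
have -> : derive1 (fun _ : R => c) = (fun=> 0).
  by apply/funext => x; rewrite derive1E derive_cst.
exact: IHk.
Qed.

Lemma smooth_funX (R : realType) (u : R -> R) (n : nat) :
  smooth_fun u -> smooth_fun (fun x => u x ^+ n).
Proof.
move=> su; elim: n => [|n IHn]; first exact: smooth_fun_cst.
have -> : (fun x => u x ^+ n.+1) = (fun x => u x * u x ^+ n).
  by apply/funext => x; rewrite exprS.
exact: smooth_funM.
Qed.

(** The span of cos and sin is stable under differentiation, hence the induction with [a] and [b]
    general. *)
Lemma smooth_fun_trig (R : realType) (a b : R) :
  smooth_fun (fun x => a * cos x + b * sin x).
Proof.
move=> k; elim: k a b => [|k IHk] a b x.
  by apply: derivableD; apply: derivableM.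
have -> : derive1n k.+1 (fun x => a * cos x + b * sin x) =
    derive1n k (fun x => b * cos x + - a * sin x).
  rewrite derive1Sn; congr derive1n; apply/funext => y.
  rewrite derive1E; apply: derive_val.
  apply: is_derive_eq.
  by rewrite /GRing.scale /=; ring.
exact: IHk.
Qed.

Lemma smooth_coord (R : realType) (n : nat) (f : R -> 'rV[R]_n.+1) :
  smooth f <-> forall j, smooth_fun (fun x => f x 0 j).
Proof.
(* Both directions share this induction step. The derivative may be taken entrywise only once the
   k-th derivative is known to be differentiable, which is known from [f] in one direction and from
   its coordinates in the other. *)
have step k : (forall j, (fun x => derive1n k f x 0 j) =
      derive1n k (fun x => f x 0 j)) ->
    (forall x, derivable (derive1n k f) x 1) ->
    forall j,
      (fun x => derive1n k.+1 f x 0 j) = derive1n k.+1 (fun x => f x 0 j).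
  move=> E D j; apply/funext => x.
  by rewrite !derive1nS !derive1E derive_mx // mxE E.
split=> sf.
  have E k : forall j,
      (fun x => derive1n k f x 0 j) = derive1n k (fun x => f x 0 j).
    by elim: k => // k IHk; apply: step => // x; exact: sf.
  by move=> j k x; rewrite -E; move/derivable_mxP: (sf k x); apply.
have E k : forall j,
      (fun x => derive1n k f x 0 j) = derive1n k (fun x => f x 0 j).
  elim: k => // k IHk; apply: step => // x.
  by apply/derivable_mxP => i j; rewrite ord1 IHk; exact: sf.
by move=> k x; apply/derivable_mxP => i j; rewrite ord1 E; exact: sf.
Qed.

Lemma derive1_mulmx (R : realType) (m n : nat) (f : R -> 'rV[R]_m.+1)
    (L : 'M[R]_(m.+1, n.+1)) (x : R) :
  derivable f x 1 -> derive1 (fun t => f t *m L) x = derive1 f x *m L.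
Proof.
move=> df.
have Dj j : is_derive x 1 (fun t => (f t *m L) 0 j)
    (\sum_k 'D_1 (fun t => f t 0 k) x * L k j).
  have -> : (fun t => (f t *m L) 0 j) = \sum_k (fun t => f t 0 k * L k j).
    by apply/funext => t; rewrite mxE fct_sumE.
  apply: is_derive_sum => k.
  have dk : is_derive x 1 (fun t => f t 0 k) ('D_1 (fun t => f t 0 k) x).
    by apply: derivableP; move/derivable_mxP: df; apply.
  apply: is_derive_eq.
  by rewrite /GRing.scale /=; ring.
have dfL : derivable (fun t => f t *m L) x 1.
  by apply/derivable_mxP => i j; rewrite ord1; have [] := Dj j.
rewrite !derive1E derive_mx // [in RHS]derive_mx //.
apply/rowP => j; rewrite !mxE derive_val; apply: eq_bigr => k _.
by rewrite !mxE.
Qed.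

Lemma derive1_scale (R : realType) (n : nat) (q : R -> R)
    (g : R -> 'rV[R]_n.+1) (x : R) :
  smooth_fun q -> smooth g ->
  derive1 (fun t => q t *: g t) x = derive1 q x *: g x + q x *: derive1 g x.
Proof.
move=> sq sg.
have dq : derivable q x 1 := sq 0%N x.
have dg : derivable g x 1 := sg 0%N x.
have dgj j : derivable (fun t => g t 0 j) x 1.
  by move/derivable_mxP: dg; apply.
have E j : (fun t => (q t *: g t) 0 j) = q * (fun t => g t 0 j).
  by apply/funext => t; rewrite mxE.
have dqg : derivable (fun t => q t *: g t) x 1.
  apply/derivable_mxP => i j; rewrite ord1 E.
  exact: derivableM dq (dgj j).
rewrite !derive1E derive_mx // (derive_mx dg).
apply/rowP => j; rewrite mxE E (deriveM dq (dgj j)).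
rewrite [RHS]mxE [in RHS]mxE [X in _ = _ + X]mxE [X in _ = _ + _ * X]mxE.
by rewrite addrC [X in X + _]mulrC.
Qed.

(** * Projective points, tangent lines and parameters modulo pi *)

Lemma same_pointP (R : realType) (n : nat) (u v : 'rV[R]_n) :
  same_point u v <-> exists2 l : R, l != 0 & v = l *: u.
Proof.
split=> [/andP[/sub_rVP[a ua] /sub_rVP[b vb]]|[l l0 ->]].
  have [v0|v0] := eqVneq v 0.
    by exists 1; rewrite ?oner_neq0 // ua v0 !scaler0.
  exists b => //; apply: contra_neq v0 => b0; by rewrite vb b0 scale0r.
by apply/andP; split; apply/sub_rVP; [exists l^-1|exists l];
  rewrite ?scalerA ?mulVf ?scale1r.
Qed.

Lemma same_pointxx (R : realType) (n : nat) (u : 'rV[R]_n) : same_point u u.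
Proof. by rewrite /same_point submx_refl. Qed.

Lemma same_point_sym (R : realType) (n : nat) (u v : 'rV[R]_n) :
  same_point u v -> same_point v u.
Proof. by rewrite /same_point andbC. Qed.

Lemma same_point_trans (R : realType) (n : nat) (u v w : 'rV[R]_n) :
  same_point u v -> same_point v w -> same_point u w.
Proof.
move=> /andP[uv vu] /andP[vw wv].
by apply/andP; split; [exact: submx_trans uv vw|exact: submx_trans wv vu].
Qed.

Lemma same_point_scaler (R : realType) (n : nat) (a : R) (u : 'rV[R]_n) :
  a != 0 -> same_point u (a *: u).
Proof. by move=> a0; apply/same_pointP; exists a. Qed.

Lemma same_point_scale (R : realType) (n : nat) (a b : R) (u v : 'rV[R]_n) :
  a != 0 -> b != 0 -> same_point (a *: u) (b *: v) <-> same_point u v.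
Proof.
move=> a0 b0; split=> uv.
  apply: same_point_trans (same_point_scaler _ a0) _.
  exact: same_point_trans uv (same_point_sym (same_point_scaler _ b0)).
apply: same_point_trans (same_point_sym (same_point_scaler _ a0)) _.
exact: same_point_trans uv (same_point_scaler _ b0).
Qed.

Lemma submx_scaleD (R : realType) (m n : nat) (a b : R) (u v : 'rV[R]_n)
    (M : 'M[R]_(m, n)) :
  a != 0 -> (u <= M)%MS -> ((b *: u + a *: v)%R <= M)%MS -> (v <= M)%MS.
Proof.
move=> a0 uM wM.
have -> : v = a^-1 *: ((b *: u + a *: v) - b *: u).
  by rewrite addrAC subrr add0r scalerA mulVf // scale1r.
apply/scalemx_sub/addmx_sub => //; rewrite eqmx_opp; exact: scalemx_sub.
Qed.

(** The two pairs of rows differ by a triangular matrix with diagonal a, a. By the product rule a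
    rescaled curve and its derivative have this shape, so rescaling keeps tangent lines. *)
Lemma eqmx_tangent_scale (R : realType) (n : nat) (a b : R) (u v : 'rV[R]_n) :
  a != 0 -> (col_mx (a *: u) (b *: u + a *: v) :=: col_mx u v)%MS.
Proof.
move=> a0; set M := col_mx _ _.
have := submx_refl M; rewrite {1}/M col_mx_sub eqmx_scale // => /andP[uM wM].
apply/eqmxP/andP; split; last by rewrite col_mx_sub uM (submx_scaleD a0 uM wM).
rewrite col_mx_sub; apply/andP; split.
  by rewrite scalemx_sub // -addsmxE addsmxSl.
by rewrite addmx_sub // scalemx_sub // -addsmxE ?addsmxSl ?addsmxSr.
Qed.

Lemma same_param_sym (R : realType) (x y : R) :
  same_param x y -> same_param y x.
Proof. by move=> [k ->]; exists (- k); rewrite rmorphN /= mulNr addrK. Qed.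

Lemma same_param_trans (R : realType) (x y z : R) :
  same_param x y -> same_param y z -> same_param x z.
Proof.
by move=> [k ->] [l ->]; exists (k + l); rewrite rmorphD /= mulrDl addrA.
Qed.

Lemma same_param_eq (R : realType) (x y : R) :
  0 <= x < pi -> 0 <= y < pi -> same_param x y -> x = y.
Proof.
move=> /andP[x0 xpi] /andP[y0 ypi] [k yE].
suff -> : x = y by [].
have p0 := pi_gt0 R.
have lt1 : k%:~R < (1 : int)%:~R :> R.
  by rewrite -(ltr_pM2r p0) mul1r; lra.
have gt1 : (-1 : int)%:~R < k%:~R :> R.
  by rewrite -(ltr_pM2r p0) mulN1r; lra.
move: lt1 gt1; rewrite !ltr_int => lt1 gt1.
have k0 : k = 0 by lia.
by rewrite yE k0 mul0r addr0.
Qed.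

Lemma same_param_fundamental (R : realType) (x : R) :
  exists2 x' : R, 0 <= x' < pi & same_param x' x.
Proof.
have p0 := pi_gt0 R.
exists (x - (Num.floor (x / pi))%:~R * pi); last first.
  by exists (Num.floor (x / pi)); rewrite subrK.
have /andP[fl fu] := floor_itv (x / pi).
apply/andP; split.
  by rewrite subr_ge0 -ler_pdivlMr.
by move: fu; rewrite ltr_pdivrMr // rmorphD /= mulrDl mul1r => fu; lra.
Qed.

Lemma sin_neq0 (R : realType) (x y : R) :
  0 <= x < pi -> 0 <= y < pi -> x != y -> sin (x - y) != 0.
Proof.
wlog xy : x y / x < y => [W x0 y0|].
  rewrite neq_lt => /orP[] xy; first by apply: W; rewrite // lt_eqF.
  by rewrite -opprB sinN oppr_eq0; apply: W; rewrite // lt_eqF.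
move=> /andP[x0 xpi] /andP[y0 ypi] _.
rewrite -opprB sinN oppr_eq0 gt_eqF // sin_gt0_pi //.
by apply/andP; split; lra.
Qed.

(** As [s] is its own inverse, the exponent [|k|] also serves negative k. With s = (-1)^d this
    applies to the curve, its heights and the bump. *)
Lemma twisted_period (R : realType) (V : lmodType R) (s : R) (u : R -> V) :
  s ^+ 2 = 1 -> (forall x, u (x + pi) = s *: u x) ->
  forall k x, u (x + k%:~R * pi) = s ^+ `|k|%N *: u x.
Proof.
move=> s2 up.
have upn (n : nat) x : u (x + n%:R * pi) = s ^+ n *: u x.
  elim: n => [|n IHn]; first by rewrite mul0r addr0 scale1r.
  by rewrite -natr1 mulrDl mul1r addrA up IHn scalerA -exprS.
case=> n x; first exact: upn.
have E : u x = s ^+ n.+1 *: u (x + (Negz n)%:~R * pi).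
  by rewrite -upn NegzE rmorphN /= mulNr subrK.
by rewrite E /= scalerA -exprD addnn -mul2n exprM s2 expr1n scale1r.
Qed.

(** * Homogeneous forms and the bump *)

Lemma meval_dhomogZ (R : comNzRingType) (n d : nat) (p : dhomog n R d)
    (v : 'I_n -> R) (c : R) :
  meval (fun i => c * v i) (mpoly_of_dhomog p) =
  c ^+ d * meval v (mpoly_of_dhomog p).
Proof.
rewrite !mevalE mulr_sumr. rewrite big_seq [RHS]big_seq; apply: eq_bigr => m mp.
have /dhomogP/(_ m mp) := dhomog_is_dhomog p.
rewrite /= mdegE => dm.
rewrite mulrCA; congr (_ * _); rewrite -dm -prodrXr -big_split /=.
by apply: eq_bigr => i _; rewrite exprMn.
Qed.

(** Since cos and sin change sign under a shift by pi, a curve given by forms of degree d picks up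
    exactly the factor (-1)^d over a period, which is sharper than periodicity of its projective
    class. *)
Lemma homog_mapN (R : realType) (d : nat) (p : 'I_4 -> dhomog 2 R d)
    (s t : R) :
  homog_map p (- s) (- t) = (-1) ^+ d *: homog_map p s t.
Proof.
apply/rowP => j; rewrite !mxE -meval_dhomogZ; apply: meval_eq => i.
by case: ifP; rewrite mulN1r.
Qed.

Definition bump_den (R : realType) (x0 e x : R) : R := sin (x - x0) ^+ 2 + e.

(* The exponent d + 2 makes bump_num a form of degree d + 2 in cos x and sin x,
   nonzero at x0. *)
Definition bump_num (R : realType) (d : nat) (x0 c e x : R) : R :=
  e * c * cos (x - x0) ^+ (d + 2).

Lemma homog_map_bump (R : realType) (d : nat) (p : 'I_4 -> dhomog 2 R d)
    (x0 c e : R) (w : 'rV[R]_4) :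
  exists p' : 'I_4 -> dhomog 2 R (d + 2), forall x,
    bump_den x0 e x *: homog_map p (cos x) (sin x) + bump_num d x0 c e x *: w =
    homog_map p' (cos x) (sin x).
Proof.
pose X (i : 'I_2) : mpoly 2 R := mpolyX R (mnm1 i).
have hX i : X i \in ishomog1 1 (@mdeg 2).
  rewrite dhomogX; apply/eqP; exact: mdeg1.
(* [X 0] and [X 1] become cos x and sin x, so the subtraction formulas turn sin (x - x0) and cos (x
   - x0) into linear forms. The constant e is homogenised by cos^2 + sin^2 = 1. *)
pose Q := (cos x0 *: X 1 - sin x0 *: X 0) ^+ 2 + e *: (X 0 ^+ 2 + X 1 ^+ 2).
pose N := (e * c) *: (cos x0 *: X 0 + sin x0 *: X 1) ^+ (d + 2).
have hQ : Q \in ishomog1 2 (@mdeg 2).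
  rewrite dhomogD ?dhomogZ //.
    by rewrite (@dhomogMn _ _ _ 1 _ 2) // rpredB ?dhomogZ.
  by rewrite dhomogD ?(@dhomogMn _ _ _ 1 _ 2).
have hN : N \in ishomog1 (d + 2) (@mdeg 2).
  rewrite dhomogZ // -[X in ishomog1 X](mul1n (d + 2)%N).
  by rewrite dhomogMn // dhomogD ?dhomogZ.
have hp j : mpoly_of_dhomog (p j) * Q + w 0 j *: N
    \in ishomog1 (d + 2) (@mdeg 2).
  apply: dhomogD; last exact: dhomogZ.
  by apply: dhomogM => //; exact: dhomog_is_dhomog.
exists (fun j => DHomog (hp j)) => x; apply/rowP => j.
rewrite !mxE /= mevalD mevalM mevalZ.
set ev := meval _.
have e0 : ev (X 0) = cos x by rewrite /ev mevalXU.
have e1 : ev (X 1) = sin x by rewrite /ev mevalXU.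
rewrite mulrC [bump_num _ _ _ _ _ * _]mulrC; congr (_ * _ + _ * _).
  rewrite /ev mevalD mevalZ mevalD !rmorphXn rmorphB /=.
  rewrite !mevalZ -/ev e0 e1 cos2Dsin2 mulr1 /bump_den sinB.
  by rewrite [sin x * _]mulrC [cos x * _]mulrC.
rewrite /ev mevalZ rmorphXn rmorphD /= !mevalZ -/ev e0 e1.
by rewrite /bump_num cosB [cos x * _]mulrC [sin x * _]mulrC.
Qed.

Lemma bump_den_gt0 (R : realType) (x0 e x : R) : 0 < e -> 0 < bump_den x0 e x.
Proof. by move=> e0; rewrite ltr_wpDl // sqr_ge0. Qed.

Lemma bump_den_pi (R : realType) (x0 e x : R) :
  bump_den x0 e (x + pi) = bump_den x0 e x.
Proof. by rewrite /bump_den addrAC sinDpi sqrrN. Qed.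

(** As d + 2 and d have the same parity, this is also the sign that a form of degree d acquires, so
    that the perturbed curve still closes up in projective space. *)
Lemma bump_num_pi (R : realType) (d : nat) (x0 c e x : R) :
  bump_num d x0 c e (x + pi) = (-1) ^+ d * bump_num d x0 c e x.
Proof.
rewrite /bump_num addrAC cosDpi -mulN1r exprMn exprD sqrrN expr1n mulr1.
by rewrite mulrCA.
Qed.

Lemma smooth_bump_den (R : realType) (x0 e : R) : smooth_fun (bump_den x0 e).
Proof.
apply: smooth_funD; last exact: smooth_fun_cst.
apply: smooth_funX.
have -> : (fun x => sin (x - x0)) =
    (fun x => - sin x0 * cos x + cos x0 * sin x).
  by apply/funext => x; rewrite sinB; ring.
exact: smooth_fun_trig.
Qed.

Lemma smooth_bump_num (R : realType) (d : nat) (x0 c e : R) :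
  smooth_fun (bump_num d x0 c e).
Proof.
apply: smooth_funM; first exact: smooth_fun_cst.
apply: smooth_funX.
have -> : (fun x => cos (x - x0)) = (fun x => cos x0 * cos x + sin x0 * sin x).
  by apply/funext => x; rewrite cosB; ring.
exact: smooth_fun_trig.
Qed.

Lemma bump_peak (R : realType) (d : nat) (x0 c e : R) :
  0 < e -> bump_num d x0 c e x0 / bump_den x0 e x0 = c.
Proof.
move=> e0; rewrite /bump_num /bump_den subrr sin0 cos0 expr1n expr0n add0r.
rewrite mulr1.
by rewrite mulrAC divff ?mul1r // gt_eqF.
Qed.

(** The numerator is at most e |c| in absolute value and the denominator exceeds s > 0, so e (|c| +
    1) < r s suffices; the added 1 keeps the divisor positive when c = 0. *)
Lemma bump_small (R : realType) (d : nat) (x0 c x r : R) :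
  sin (x - x0) != 0 -> 0 < r ->
  \forall e \near 0^'+, `|bump_num d x0 c e x / bump_den x0 e x| < r.
Proof.
move=> s0 r0; set s := sin (x - x0) ^+ 2.
have sp : 0 < s by rewrite exprn_even_gt0.
have K0 : 0 < `|c| + 1 by rewrite ltr_wpDl.
near=> e.
have e0 : 0 < e by near: e; exact: nbhs_right_gt.
have er : e < r * s / (`|c| + 1).
  by near: e; apply: nbhs_right_lt; rewrite divr_gt0 // mulr_gt0.
rewrite normrM normfV (gtr0_norm (bump_den_gt0 x0 x e0)).
rewrite ltr_pdivrMr ?bump_den_gt0 // /bump_num !normrM (gtr0_norm e0) normrX.
have cle : `|cos (x - x0)| ^+ (d + 2) <= 1.
  by rewrite exprn_ile1 // ler_norml cos_geN1 cos_le1.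
apply: le_lt_trans (_ : _ <= e * `|c|) _.
  by rewrite ler_piMr // mulr_ge0 // ltW.
move: er; rewrite ltr_pdivlMr // => er.
apply: le_lt_trans (_ : _ <= e * (`|c| + 1)) _.
  by rewrite ler_wpM2l ?lerDl // ltW.
apply: lt_trans er _.
by rewrite ltr_pM2l // /bump_den ltrDl.
Unshelve. all: by end_near. Qed.

(** * Immersions and genericity under rescaling and lifting *)

Lemma smooth_scale (R : realType) (n : nat) (q : R -> R)
    (g : R -> 'rV[R]_n.+1) :
  smooth_fun q -> smooth g -> smooth (fun x => q x *: g x).
Proof.
move=> sq /smooth_coord sg; apply/smooth_coord => j.
have -> : (fun x => (q x *: g x) 0 j) = (fun x => q x * g x 0 j).
  by apply/funext => x; rewrite mxE.
exact: smooth_funM.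
Qed.

Lemma smooth_addr (R : realType) (n : nat) (f g : R -> 'rV[R]_n.+1) :
  smooth f -> smooth g -> smooth (fun x => f x + g x).
Proof.
move=> /smooth_coord sf /smooth_coord sg; apply/smooth_coord => j.
have -> : (fun x => (f x + g x) 0 j) = (fun x => f x 0 j + g x 0 j).
  by apply/funext => x; rewrite mxE.
exact: smooth_funD.
Qed.

Lemma smooth_cst (R : realType) (n : nat) (w : 'rV[R]_n.+1) :
  smooth (fun _ : R => w).
Proof. by apply/smooth_coord => j; exact: smooth_fun_cst. Qed.

Lemma tangent_scale (R : realType) (n : nat) (q : R -> R)
    (g : R -> 'rV[R]_n.+1) (x : R) :
  smooth_fun q -> smooth g -> q x != 0 ->
  (col_mx (q x *: g x) (derive1 (fun t => q t *: g t) x)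
     :=: col_mx (g x) (derive1 g x))%MS.
Proof.
move=> sq sg q0; rewrite (derive1_scale x sq sg).
exact: eqmx_tangent_scale.
Qed.

Lemma immersed_scale (R : realType) (n : nat) (q : R -> R)
    (g : R -> 'rV[R]_n.+1) :
  smooth_fun q -> (forall x, q x != 0) ->
  immersed_curve g -> immersed_curve (fun x => q x *: g x).
Proof.
move=> sq q0 [sg g0 gpi rg]; split.
- exact: smooth_scale.
- by move=> x; rewrite scaler_eq0 negb_or q0 g0.
- by move=> x; apply/same_point_scale.
by move=> x; rewrite tangent_scale.
Qed.

(** For transversality: the new derivatives are nonzero multiples of the old ones up to multiples of
    [g x] and [g y], which span one line at a double point, so the new row space contains the three
    old rows. *)
Lemma generic_scale (R : realType) (q : R -> R) (g : R -> 'rV[R]_3) :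
  smooth_fun q -> (forall x, q x != 0) ->
  generic g -> generic (fun x => q x *: g x).
Proof.
move=> sq q0 [ig fg tg rg]; have [sg g0 gpi _] := ig.
have E x y : same_point (q x *: g x) (q y *: g y) <-> same_point (g x) (g y).
  exact: same_point_scale.
split.
- exact: immersed_scale.
- apply: sub_finite_set fg => x /= [x0 [y [xy /E gxy]]].
  by split=> //; exists y.
- by move=> x y z /E gxy /E gxz; exact: tg gxy gxz.
move=> x y xy /E gxy; apply/eqP; rewrite eqn_leq rank_leq_row /=.
rewrite -{1}(rg x y xy gxy); apply: mxrankS.
set M := col_mx _ (col_mx _ _).
have := submx_refl M; rewrite {1}/M !col_mx_sub => /and3P[].
rewrite (derive1_scale x sq sg).
rewrite (derive1_scale y sq sg) => gM dxM dyM.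
rewrite eqmx_scale // in gM.
have gyM : (g y <= M)%MS by case/andP: gxy => _ /submx_trans; apply.
by rewrite gM (submx_scaleD (q0 x) gM dxM)
  (submx_scaleD (q0 y) gyM dyM).
Qed.

(** Multiplication by [L] cannot raise a rank, so independence of the projected point and derivative
    forces independence upstairs. *)
Lemma immersed_lift (R : realType) (f : R -> 'rV[R]_4) (L : 'M[R]_(4, 3)) :
  smooth f -> (forall x, same_point (f (x + pi)) (f x)) ->
  immersed_curve (projection f L) -> immersed_curve f.
Proof.
move=> sf fpi [_ g0 _ rg]; split=> //.
  by move=> x; apply: contra_neq (g0 x) => f0; rewrite /projection f0 mul0mx.
move=> x; apply/eqP; rewrite eqn_leq rank_leq_row /=.
have := rg x; rewrite /projection (derive1_mulmx _ (sf 0%N x)) -mul_col_mx => r.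
by apply: leq_trans (mxrankM_maxl _ L); rewrite r.
Qed.

(** * Coordinates along the fibres of the projection *)

Lemma fibre_coordinatesE (R : realType) (L : 'M[R]_(4, 3)) (h : 'cV[R]_4)
    (u : 'rV[R]_4) :
  u *m (row_mx L h : 'M[R]_4) = row_mx (u *m L) (u *m h) :> 'rV[R]_(3 + 1).
Proof. exact: mul_mx_row. Qed.

Lemma fibre_inj (R : realType) (L : 'M[R]_(4, 3)) (h : 'cV[R]_4)
    (u v : 'rV[R]_4) :
  (row_mx L h : 'M[R]_4) \in unitmx ->
  u *m L = v *m L -> (u *m h) 0 0 = (v *m h) 0 0 -> u = v.
Proof.
move=> MU uL uh; apply: (can_inj (mulmxK MU)).
rewrite !fibre_coordinatesE uL; suff -> : u *m h = v *m h by [].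
by apply/matrixP => i j; rewrite !ord1.
Qed.

(** The witness is the last row of the inverse matrix. It spans the center, so adding multiples of
    it moves a point along its fibre. *)
Lemma fibre_direction (R : realType) (L : 'M[R]_(4, 3)) (h : 'cV[R]_4) :
  (row_mx L h : 'M[R]_4) \in unitmx ->
  exists w : 'rV[R]_4, w *m L = 0 /\ (w *m h) 0 0 = 1.
Proof.
move=> MU; pose w0 : 'rV[R]_(3 + 1) := row_mx 0 1%:M.
exists ((w0 : 'rV[R]_4) *m invmx (row_mx L h : 'M[R]_4)).
have := mulmxKV MU (w0 : 'rV[R]_4).
rewrite fibre_coordinatesE => E; have [-> ->] := @eq_row_mx _ 1 3 1 _ _ _ _ E.
by rewrite mxE.
Qed.

(** * Signs of height differences for small e *)

Lemma sgr_perturb (R : realDomainType) (u v : R) :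
  `|v| < `|u| -> Num.sg (u + v) = Num.sg u.
Proof.
rewrite ltr_norml => /andP[].
case: (ltrgt0P u) => [u0|u0|->] lo hi; last by lra.
  by rewrite !gtr0_sg //; lra.
by rewrite !ltr0_sg //; lra.
Qed.

Definition bump_height (R : realType) (d : nat) (x0 c e x : R) : R :=
  bump_num d x0 c e x / bump_den x0 e x.

(* The sign by which the strand order at the double point [g x] is to change. *)
Definition swap_sign (R : realType) (n : nat) (g : R -> 'rV[R]_n)
    (x0 x : R) : R :=
  if `[< same_point (g x) (g x0) >] then -1 else 1.

Lemma bump_height_pi (R : realType) (d : nat) (x0 c e x : R) :
  bump_height d x0 c e (x + pi) = (-1) ^+ d * bump_height d x0 c e x.
Proof. by rewrite /bump_height bump_num_pi bump_den_pi -mulrA. Qed.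

(** With g y = l g x, the number l u - v compares two heights in one fibre. Each bump changes it by
    less than half its absolute value; the bound at [x] is divided by |l| + 1 to absorb the factor
    l. *)
Lemma near_sign_preserved (R : realType) (d : nat) (x0 c : R) (l u v x y : R) :
  sin (x - x0) != 0 -> sin (y - x0) != 0 -> l * u - v != 0 ->
  \forall e \near 0^'+,
    Num.sg (l * (u + bump_height d x0 c e x) - (v + bump_height d x0 c e y)) =
    Num.sg (l * u - v).
Proof.
move=> sx sy D0; set D := l * u - v.
have D2 : 0 < `|D| / 2 by rewrite divr_gt0 // normr_gt0.
have l1 : 0 < `|l| + 1 by rewrite ltr_wpDl.
near=> e.
have bx : `|bump_height d x0 c e x| < `|D| / 2 / (`|l| + 1).
  by near: e; apply: bump_small; rewrite // divr_gt0.
have by_ : `|bump_height d x0 c e y| < `|D| / 2 by near: e; exact: bump_small.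
have -> : l * (u + bump_height d x0 c e x) - (v + bump_height d x0 c e y) =
    D + (l * bump_height d x0 c e x - bump_height d x0 c e y).
  by rewrite /D; ring.
apply: sgr_perturb; apply: le_lt_trans (ler_normB _ _) _; rewrite normrM.
have : `|l| * `|bump_height d x0 c e x| <=
    (`|l| + 1) * `|bump_height d x0 c e x|.
  by rewrite ler_wpM2r // lerDl.
by move: bx; rewrite ltr_pdivlMr // mulrC => bx bl; lra.
Unshelve. all: by end_near. Qed.

(** The bump at [x0] is exactly c for every e > 0, so it turns the difference D into -D; the bump at
    [y] is then too small to affect the sign. *)
Lemma near_sign_swapped_l (R : realType) (d : nat) (x0 c : R) (l u v y : R) :
  sin (y - x0) != 0 -> l * u - v != 0 -> l * c = - 2 * (l * u - v) ->
  \forall e \near 0^'+,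
    Num.sg (l * (u + bump_height d x0 c e x0) - (v + bump_height d x0 c e y)) =
    - Num.sg (l * u - v).
Proof.
move=> sy D0 lc; set D := l * u - v.
near=> e.
have e0 : 0 < e by near: e; exact: nbhs_right_gt.
have by_ : `|bump_height d x0 c e y| < `|D|.
  by near: e; apply: bump_small; rewrite // normr_gt0.
rewrite {1}/bump_height bump_peak // mulrDr lc.
have -> : l * u + -2 * (l * u - v) - (v + bump_height d x0 c e y) =
    - (D + bump_height d x0 c e y) by rewrite /D; ring.
by rewrite sgrN sgr_perturb.
Unshelve. all: by end_near. Qed.

(** Now [x0] carries the second strand, so c enters with a minus sign and without the factor l:
    subtracting 2 D again gives -D. *)
Lemma near_sign_swapped_r (R : realType) (d : nat) (x0 c : R) (l u v x : R) :
  sin (x - x0) != 0 -> l * u - v != 0 -> c = 2 * (l * u - v) ->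
  \forall e \near 0^'+,
    Num.sg (l * (u + bump_height d x0 c e x) - (v + bump_height d x0 c e x0)) =
    - Num.sg (l * u - v).
Proof.
move=> sx D0 lc; set D := l * u - v.
have l1 : 0 < `|l| + 1 by rewrite ltr_wpDl.
near=> e.
have e0 : 0 < e by near: e; exact: nbhs_right_gt.
have bx : `|bump_height d x0 c e x| < `|D| / (`|l| + 1).
  by near: e; apply: bump_small; rewrite // divr_gt0 // normr_gt0.
rewrite {2}/bump_height bump_peak // {2}lc mulrDr.
have -> : l * u + l * bump_height d x0 c e x - (v + 2 * (l * u - v)) =
    - (D + - (l * bump_height d x0 c e x)) by rewrite /D; ring.
rewrite sgrN sgr_perturb // normrN normrM.
have : `|l| * `|bump_height d x0 c e x| <=
    (`|l| + 1) * `|bump_height d x0 c e x|.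
  by rewrite ler_wpM2r // lerDl.
by move: bx; rewrite ltr_pdivlMr // mulrC => bx bl; lra.
Unshelve. all: by end_near. Qed.

(** As in [goes_over], a and b express one nonzero vector through both strands, and the sign of the
    difference tells which is higher. An equation between signs covers kept and exchanged crossings
    at once. *)
Definition crossing_swapped (R : realType) (n d : nat) (g : R -> 'rV[R]_n)
    (eta : R -> R) (x0 c e x y : R) : Prop :=
  forall a b, a *: g x = b *: g y -> a *: g x != 0 ->
    Num.sg (a * (eta x + bump_height d x0 c e x) -
            b * (eta y + bump_height d x0 c e y)) =
    swap_sign g x0 x * Num.sg (a * eta x - b * eta y).

(* The peak -2 (l0 eta x0 - eta y0) / l0 moves the strand through x0 by twice
   its distance to the strand through y0, hence to the other side of it. *)
Lemma near_crossing_swapped (R : realType) (n d : nat) (g : R -> 'rV[R]_n)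
    (eta : R -> R) (x0 y0 l0 x y : R) :
  (forall x, g x != 0) ->
  (forall x y z, same_point (g x) (g y) -> same_point (g x) (g z) ->
     [\/ same_param x y, same_param x z | same_param y z]) ->
  (forall x y l, ~ same_param x y -> g y = l *: g x ->
     l * eta x - eta y != 0) ->
  0 <= x0 < pi -> 0 <= y0 < pi -> ~ same_param x0 y0 ->
  l0 != 0 -> g y0 = l0 *: g x0 ->
  0 <= x < pi -> 0 <= y < pi -> ~ same_param x y ->
  \forall e \near 0^'+,
    crossing_swapped d g eta x0 (- 2 * (l0 * eta x0 - eta y0) / l0) e x y.
Proof.
move=> g0 tg Heta x0I y0I xy0 l00 gy0 xI yI xy.
set c := - 2 * _ / _.
have sc z a b : a *: g z = b *: g z -> a = b.
  move=> /eqP; rewrite -subr_eq0 -scalerBl scaler_eq0 (negbTE (g0 z)) orbF.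
  by rewrite subr_eq0 => /eqP.
have sp0 : same_point (g x0) (g y0) by apply/same_pointP; exists l0.
(* There are no triple points, so [y0] is the only other parameter in [0, pi) over the crossing. *)
have partner z : 0 <= z < pi -> ~ same_param x0 z -> same_point (g x0) (g z) ->
    z = y0.
  move=> zI x0z gz; have [//|//|] := tg _ _ _ sp0 gz.
  by move=> /(same_param_eq y0I zI).
have [gxy|gxy] := pselect (same_point (g x) (g y)); last first.
  apply: nearW => e a b ab a0; case: gxy; apply/same_pointP.
  have b0 : b != 0 by apply: contra_neq a0; rewrite ab => ->; rewrite scale0r.
  have a0' : a != 0 by apply: contra_neq a0 => ->; rewrite scale0r.
  exists (b^-1 * a); first by rewrite mulf_neq0 // invr_neq0.
  by rewrite -scalerA ab scalerA mulVf // scale1r.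
have /same_pointP[l ln0 gy] := gxy.
have D0 := Heta x y l xy gy.
(* Since [g x] is nonzero, a = b l. Both differences then carry the factor b, and multiplicativity
   of the sign reduces the claim to b = 1. *)
suff : \forall e \near 0^'+,
    Num.sg (l * (eta x + bump_height d x0 c e x) -
            (eta y + bump_height d x0 c e y)) =
    swap_sign g x0 x * Num.sg (l * eta x - eta y).
  apply: filterS => e E a b ab _.
  have -> : a = b * l by apply: (sc x); rewrite ab gy scalerA.
  by rewrite -!mulrA -!mulrBr !sgrM E mulrCA.
have sx0 : x != x0 -> sin (x - x0) != 0 by exact: sin_neq0.
have sy0 : y != x0 -> sin (y - x0) != 0 by exact: sin_neq0.
have [xE|xx0] := eqVneq x x0.
  have yE : y = y0 by apply: partner => //; rewrite -xE.
  have lE : l = l0 by apply: (sc x0); rewrite -gy0 -yE -xE.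
  have -> : swap_sign g x0 x = -1.
    by rewrite /swap_sign xE asboolT //; exact: same_pointxx.
  rewrite mulN1r xE; apply: near_sign_swapped_l.
  - apply: sy0; apply/eqP => yx0; apply: xy; rewrite xE yx0.
    by exists 0; rewrite mul0r addr0.
  - by rewrite -xE.
  by rewrite /c lE yE mulrC divfK.
(* The strands occur in the other order: l = 1 / l0, and the peak reads 2 (l eta y0 - eta x0). *)
have [yE|yx0] := eqVneq y x0.
  have xE : x = y0.
    apply: partner => //; last by apply: same_point_sym; rewrite -yE.
    by rewrite -yE => /same_param_sym.
  have lE : l * l0 = 1.
    apply: (sc x0); rewrite scale1r -scalerA -gy0 -xE.
    by rewrite -yE gy.
  have -> : swap_sign g x0 x = -1.
    by rewrite /swap_sign asboolT // -yE.
  rewrite mulN1r yE; apply: near_sign_swapped_r => //.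
  - exact: sx0.
  - by rewrite -yE.
  have -> : l = l0^-1 by rewrite -[RHS]mul1r -lE mulfK.
  by rewrite /c xE; field.
(* Otherwise [x], [y] and [x0] would be three parameters of one point. *)
have -> : swap_sign g x0 x = 1.
  rewrite /swap_sign asboolF // => gx.
  have := tg _ _ _ gxy gx.
  case=> [//|/(same_param_eq xI x0I)/eqP|/(same_param_eq yI x0I)/eqP].
    by rewrite (negbTE xx0).
  by rewrite (negbTE yx0).
by rewrite mul1r; apply: near_sign_preserved; [exact: sx0|exact: sy0|].
Qed.

(** Filters are closed under finite intersections; this turns one threshold on e per double point
    into a common one. *)
Lemma near_all_seq (R : realType) (T : eqType) (s : seq T)
    (P : R -> T -> Prop) :
  (forall x, x \in s -> \forall e \near 0^'+, P e x) ->
  \forall e \near (0 : R)^'+, forall x, x \in s -> P e x.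
Proof.
elim: s => [|z s IHs] H; first by apply: nearW.
have Hz : \forall e \near 0^'+, P e z by apply: H; rewrite mem_head.
have Hs : \forall e \near (0 : R)^'+, forall x, x \in s -> P e x.
  by apply: IHs => x xs; apply: H; rewrite in_cons xs orbT.
apply: filterS2 Hz Hs => e Pz Ps x.
by rewrite in_cons => /predU1P[->//|]; exact: Ps.
Qed.

(* Antiperiodicity reduces the claim to parameters in [0, pi), of which only
   finitely many belong to double points. *)
Lemma near_all_crossings_swapped (R : realType) (d : nat) (g : R -> 'rV[R]_3)
    (eta : R -> R) (x0 y0 l0 : R) :
  generic g ->
  (forall x, g (x + pi) = (-1) ^+ d *: g x) ->
  (forall x, eta (x + pi) = (-1) ^+ d * eta x) ->
  (forall x y l, ~ same_param x y -> g y = l *: g x ->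
     l * eta x - eta y != 0) ->
  0 <= x0 < pi -> 0 <= y0 < pi -> ~ same_param x0 y0 ->
  l0 != 0 -> g y0 = l0 *: g x0 ->
  \forall e \near 0^'+, forall x y, ~ same_param x y ->
    crossing_swapped d g eta x0 (- 2 * (l0 * eta x0 - eta y0) / l0) e x y.
Proof.
move=> [[_ g0 _ _] /finite_seqP[s sE] tg _] gpi etapi Heta x0I y0I xy0 l00 gy0.
set c := - 2 * _ / _.
have s2 : ((-1) ^+ d) ^+ 2 = 1 :> R by rewrite exprAC sqrrN !expr1n.
have sI z : z \in s -> 0 <= z < pi.
  by move=> zs; have : [set` s] z by []; rewrite -sE => -[].
have : \forall e \near (0 : R)^'+, forall x, x \in s ->
    forall y, y \in s -> ~ same_param x y ->
      crossing_swapped d g eta x0 c e x y.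
  apply: near_all_seq => x xs; apply: near_all_seq => y ys.
  have [xy|xy] := pselect (same_param x y); first by apply: nearW.
  have [xI yI] := (sI _ xs, sI _ ys).
  have : \forall e \near (0 : R)^'+, crossing_swapped d g eta x0 c e x y.
    exact: near_crossing_swapped.
  by apply: filterS => e.
apply: filterS => e H x y xy a b ab a0.
have [x' x'I [k xE]] := same_param_fundamental x.
have [y' y'I [m yE]] := same_param_fundamental y.
have xy' : ~ same_param x' y'.
  move=> xy'; apply: xy; apply: same_param_trans (_ : same_param y' y).
    apply: same_param_trans xy'; apply: same_param_sym; by exists k.
  by exists m.
have gE := twisted_period s2 gpi.
(* [R^o] views the scalars as a module over themselves, so that the lemma for vector-valued
   functions applies. *)
have etaE := @twisted_period R R^o _ _ s2 etapi.
have bE := @twisted_period R R^o _ _ s2 (bump_height_pi d x0 c e).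
set si := (fun k : int => ((-1) ^+ d) ^+ `|k|%N : R) in gE etaE bE.
have si0 j : si j != 0 by rewrite /si !expf_neq0 // oppr_eq0 oner_neq0.
have gx : g x = si k *: g x' by rewrite xE gE.
have gy : g y = si m *: g y' by rewrite yE gE.
(* The signs acquired by moving into [0, pi) are absorbed into the coefficients a and b. *)
have ab' : (a * si k) *: g x' = (b * si m) *: g y' by rewrite -!scalerA -gx -gy.
have a0' : (a * si k) *: g x' != 0 by rewrite -scalerA -gx.
have gxy : same_point (g x') (g y').
  apply/same_pointP.
  have bm0 : b * si m != 0.
    by apply: contra_neq a0'; rewrite ab' => ->; rewrite scale0r.
  have ak0 : a * si k != 0 by apply: contra_neq a0' => ->; rewrite scale0r.
  exists ((b * si m)^-1 * (a * si k)); first by rewrite mulf_neq0 // invr_neq0.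
  by rewrite -[RHS]scalerA ab' scalerA mulVf // scale1r.
have x's : x' \in s.
  suff : [set` s] x' by [].
  by rewrite -sE; split=> //; exists y'.
have y's : y' \in s.
  suff : [set` s] y' by [].
  rewrite -sE; split=> //; exists x'; split; last exact: same_point_sym.
  by move=> /same_param_sym.
have := H x' x's y' y's xy' _ _ ab' a0'.
have -> : swap_sign g x0 x = swap_sign g x0 x'.
  rewrite /swap_sign; congr (if _ then _ else _).
  have gxx' : same_point (g x') (g x) by rewrite gx; exact: same_point_scaler.
  apply: asbool_equiv_eq; split; first exact: same_point_trans.
  by apply: same_point_trans; exact: same_point_sym.
by rewrite xE yE !etaE !bE -!scalerDr /GRing.scale /= !mulrA; exact.
Qed.

(** * Crossing information of the perturbed knot *)

Lemma sgr_sub1 (R : realDomainType) (a b : R) : (b < a) = (Num.sg (a - b) == 1).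
Proof. by rewrite sgr_cp0 subr_gt0. Qed.

(** Here s is 1 or -1, which treats kept and exchanged crossings together: passing from v to -v
    reverses the fibre and hence the order of the strands. Tangent lines are unaffected by [q], so
    the same two parameters serve on both sides, with rescaled coefficients. *)
Lemma goes_over_rescaled (R : realType) (f F : R -> 'rV[R]_4)
    (L : 'M[R]_(4, 3)) (h : 'cV[R]_4) (q : R -> R) (s : R) (v w : 'rV[R]_3) :
  smooth_fun q -> (forall x, q x != 0) -> smooth (projection f L) ->
  (forall x, projection F L x = q x *: projection f L x) ->
  s * s = 1 ->
  (forall x y a b, ~ same_param x y ->
     v = a *: projection F L x -> v = b *: projection F L y ->
     Num.sg (a * (F x *m h) 0 0 - b * (F y *m h) 0 0) =
     s * Num.sg (a * q x * (f x *m h) 0 0 - b * q y * (f y *m h) 0 0)) ->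
  goes_over (projection_diagram F L h) v w <->
  goes_over (projection_diagram f L h) (s *: v) w.
Proof.
move=> sq q0 sg FE s2 HS.
have s0 : s != 0.
  by apply: contra_eq_neq s2 => ->; rewrite mul0r eq_sym oner_neq0.
have FEf : projection F L = (fun x => q x *: projection f L x).
  exact/funext.
have sgs u : Num.sg (s * u) = s * Num.sg u.
  have : (s == 1) || (s == -1) by rewrite -eqf_sqr expr1n expr2 s2.
  by case/orP => /eqP->; rewrite ?mul1r ?mulN1r ?sgrN.
have tangent x : (col_mx v w == col_mx (projection F L x)
      (derive1 (projection F L) x))%MS =
    (col_mx (s *: v) w == col_mx (projection f L x)
      (derive1 (projection f L) x))%MS.
  have E1 : (col_mx (s *: v) w :=: col_mx v w)%MS.
    apply: eqmx_trans (eqmx_sym (addsmxE _ _)) _.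
    apply: eqmx_trans _ (addsmxE _ _); apply: adds_eqmx => //.
    exact: eqmx_scale.
  have E2 := tangent_scale sq sg (q0 x).
  by rewrite FEf !E2 !E1.
split=> /=.
  move=> [x [y [a [b [[v0 xy] va vb tg ov]]]]].
  exists x, y, (s * (a * q x)), (s * (b * q y)); split.
  - by rewrite scaler_eq0 negb_or s0 v0.
  - by rewrite -!scalerA -FE -va.
  - by rewrite -!scalerA -FE -vb.
  - by rewrite -tangent.
  move: ov; rewrite !sgr_sub1 (HS _ _ _ _ xy va vb) => /eqP E.
  by rewrite -!mulrA -mulrBr sgs !mulrA E.
move=> [x [y [a [b [[v0 xy] va vb tg ov]]]]].
have va' : v = (s * a / q x) *: projection F L x.
  by rewrite FE scalerA divfK // -scalerA -va scalerA s2 scale1r.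
have vb' : v = (s * b / q y) *: projection F L y.
  by rewrite FE scalerA divfK // -scalerA -vb scalerA s2 scale1r.
exists x, y, (s * a / q x), (s * b / q y); split=> //.
- by split=> //; apply: contraNneq v0 => ->; rewrite scaler0.
- by rewrite tangent.
rewrite sgr_sub1 (HS _ _ _ _ xy va' vb') !divfK // -!mulrA -mulrBr sgs mulrA s2.
by rewrite mul1r -sgr_sub1.
Qed.

Theorem theorem2p4 (R : realType) (d : nat) (D1 D2 : diagram R)
  (hD1 : knot_diagram D1) (hD2 : knot_diagram D2)
  (hD12 : crossing_change D1 D2) :
  (exists f, rational_knot d f /\ has_diagram f D1) ->
  (exists f, rational_knot (d + 2) f /\ has_diagram f D2).
Proof.
move=> [f [[kf [p fE]] [L [h [dM gen D1E]]]]].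
case: hD12 => z [[w0 over_z] shE over_at over_off].
have [[sf f0 fpi rf] inj_f] := kf.
pose g := projection f L.
have [[sg g0 _ _] _ tg _] := gen.
have MU : (row_mx L h : 'M[R]_4) \in unitmx by rewrite unitmxE unitfE gt_eqF.
have fpid x : f (x + pi) = (-1) ^+ d *: f x.
  by rewrite !fE cosDpi sinDpi homog_mapN.
pose eta x : R := (f x *m h) 0 0.
have gpid x : g (x + pi) = (-1) ^+ d *: g x.
  by rewrite /g /projection fpid scalemxAl.
have etapid x : eta (x + pi) = (-1) ^+ d * eta x.
  by rewrite /eta fpid -scalemxAl mxE.
(* Equal heights over a double point would make two points of [f] coincide, as [row_mx L h] is
   invertible. *)
have Heta x y l : ~ same_param x y -> g y = l *: g x -> l * eta x - eta y != 0.
  move=> xy gy; apply/eqP => /eqP; rewrite subr_eq0 => /eqP E; apply: xy.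
  apply: inj_f; apply/same_pointP; exists l.
    by apply: contra_neq (g0 y) => l0; rewrite -/(g y) gy l0 scale0r.
  apply: (fibre_inj MU); first by rewrite -scalemxAl.
  by rewrite -scalemxAl [RHS]mxE; exact: esym E.
have zNz : same_point (- z) z.
  by rewrite -[X in same_point X](scaleN1r z); apply: same_point_sym;
    apply: same_point_scaler; rewrite oppr_eq0 oner_neq0.
(* The strand on top in [D2] seen from z is on top in [D1] seen from -z. As [D1] is the diagram of
   [f], this produces the two parameters of the crossing. *)
have : goes_over D1 (- z) w0.
  by apply/(over_at _ _ zNz); rewrite /goes_under opprK.
rewrite D1E => -[x1 [y1 [a [b [[z0 xy1] za zb _ _]]]]].
have spz c x : - z = c *: g x -> same_point z (g x).
  move=> E; apply: same_point_trans (same_point_sym zNz) _.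
  apply: same_point_sym; apply/same_pointP; exists c => //.
  by apply: contraNneq z0 => c0; rewrite E c0 scale0r.
have spp x x' : same_param x' x -> same_point (g x) (g x').
  move=> [k ->].
  have s2 : ((-1) ^+ d) ^+ 2 = 1 :> R by rewrite exprAC sqrrN !expr1n.
  rewrite (twisted_period s2 gpid); apply: same_point_sym.
  by apply: same_point_scaler; rewrite !expf_neq0 // oppr_eq0 oner_neq0.
have [x0 x0I xx0] := same_param_fundamental x1.
have [y0 y0I yy0] := same_param_fundamental y1.
have xy0 : ~ same_param x0 y0.
  move=> E; apply: xy1; apply: same_param_trans yy0.
  exact: same_param_trans (same_param_sym xx0) E.
have zx0 : same_point z (g x0) := same_point_trans (spz _ _ za) (spp _ _ xx0).
have zy0 : same_point z (g y0) := same_point_trans (spz _ _ zb) (spp _ _ yy0).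
have /same_pointP[l0 l00 gy0] := same_point_trans (same_point_sym zx0) zy0.
have near_swap :=
  near_all_crossings_swapped gen gpid etapid Heta x0I y0I xy0 l00 gy0.
set c := - 2 * _ / _ in near_swap.
have [e [e0 swap]] : exists e : R, 0 < e /\ forall x y, ~ same_param x y ->
    crossing_swapped d g eta x0 c e x y.
  have : \forall e \near (0 : R)^'+, 0 < e /\ forall x y, ~ same_param x y ->
      crossing_swapped d g eta x0 c e x y.
    by apply: filterS2 near_swap; [move=> e ?|exact: nbhs_right_gt].
  exact: filter_ex.
have [w [wL wh]] := fibre_direction MU.
pose q := bump_den x0 e; pose r := bump_num d x0 c e.
have q0 x : q x != 0 by rewrite gt_eqF // bump_den_gt0.
have sq : smooth_fun q by exact: smooth_bump_den.
pose F x := q x *: f x + r x *: w.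
have FL x : projection F L x = q x *: g x.
  by rewrite /projection /F mulmxDl -!scalemxAl wL scaler0 addr0.
have Fh x : (F x *m h) 0 0 = q x * (eta x + bump_height d x0 c e x).
  rewrite /F mulmxDl -!scalemxAl mxE [X in X + _]mxE [X in _ + X]mxE.
  rewrite wh mulr1 mulrDr.
  by congr (_ + _); rewrite /bump_height mulrCA divff // mulr1.
have FLE : projection F L = (fun x => q x *: g x) by exact/funext.
have genF : generic (projection F L) by rewrite FLE; exact: generic_scale.
have Fswap v x y a' b' : v != 0 -> ~ same_param x y ->
    v = a' *: projection F L x -> v = b' *: projection F L y ->
    Num.sg (a' * (F x *m h) 0 0 - b' * (F y *m h) 0 0) =
    swap_sign g x0 x * Num.sg (a' * q x * eta x - b' * q y * eta y).
  move=> v0 xy va vb; rewrite !Fh !mulrA; apply: swap => //.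
    by rewrite -!scalerA -!FL -va -vb.
  by rewrite -scalerA -FL -va.
(* The sign depends only on the point [v], which is the form in which [crossing_change]
   distinguishes its cases. *)
have swap_signE v x a' : v != 0 -> v = a' *: projection F L x ->
    swap_sign g x0 x = if `[< same_point v z >] then -1 else 1.
  move=> v0 va; rewrite /swap_sign; congr (if _ then _ else _).
  have vx : same_point v (g x).
    apply: same_point_sym; apply/same_pointP; exists (a' * q x).
      apply: contraNneq v0 => E.
      by rewrite va FL scalerA E scale0r.
    by rewrite va FL scalerA.
  apply: asbool_equiv_eq; split=> E.
    apply: same_point_trans (same_point_sym zx0).
    exact: same_point_trans vx E.
  apply: same_point_trans zx0.
  exact: same_point_trans (same_point_sym vx) E.
have overF v w' : goes_over (projection_diagram F L h) v w' <->
    goes_over D1 ((if `[< same_point v z >] then -1 else 1) *: v) w'.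
  (* Both sides are false at v = 0, since [goes_over] demands a nonzero vector. *)
  have [->|v0] := eqVneq v 0.
    by rewrite scaler0 D1E; split=> -[x [y [a' [b' [[/eqP]]]]]].
  rewrite D1E.
  have rescaled := @goes_over_rescaled R f F L h q _ v w' sq q0 sg FL.
  apply: rescaled.
    by case: ifP; rewrite ?mulrNN mulr1.
  move=> x y a' b' xy va vb; rewrite (Fswap _ _ _ _ _ v0 xy va vb).
  by rewrite (swap_signE _ _ _ v0 va).
(* Coinciding points of [F] project to a double point with height difference zero. The sign formula
   then makes the difference for [f] vanish as well, against [Heta]. *)
have injF x y : same_point (F x) (F y) -> same_param x y.
  move=> /same_pointP[l l1 FyE]; apply: contrapT => xy.
  have Fg0 t : projection F L t != 0 by rewrite FL scaler_eq0 negb_or q0 g0.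
  have vE : projection F L y = l *: projection F L x.
    by rewrite /projection FyE scalemxAl.
  have := Fswap _ _ _ _ 1 (Fg0 y) xy vE; rewrite scale1r => /(_ erefl).
  rewrite mul1r mul1r FyE -scalemxAl [X in _ - X]mxE subrr sgr0 => /esym/eqP.
  rewrite mulf_eq0 sgr_eq0.
  have -> : (swap_sign g x0 x == 0) = false.
    by rewrite /swap_sign; case: ifP; rewrite ?oppr_eq0 oner_eq0.
  move=> /= E; have gy : g y = (l * q x / q y) *: g x.
    by apply: (scalerI (q0 y)); rewrite -FL vE FL !scalerA [in RHS]mulrC divfK.
  have /negP[] := Heta _ _ _ xy gy.
  move: E; rewrite !subr_eq0 => /eqP E.
  by rewrite mulrAC E mulrAC divff // mul1r.
exists F; split.
  split.
    split; last exact: injF.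
    apply: (immersed_lift (L := L)); last by case: genF.
      apply: smooth_addr; first exact: smooth_scale sq sf.
      by apply: smooth_scale; [exact: smooth_bump_num|exact: smooth_cst].
    move=> x; apply: same_point_sym; apply/same_pointP; exists ((-1) ^+ d).
      by rewrite expf_neq0 // oppr_eq0 oner_neq0.
    rewrite /F /q /r bump_den_pi bump_num_pi fpid scalerDr !scalerA.
    by rewrite mulrC.
  have [p' p'E] := homog_map_bump p x0 c e w.
  by exists p' => x; rewrite -p'E /F fE.
exists L, h; split=> //.
case: D2 shE over_z over_at over_off {hD2} => sh2 go2 /=.
move=> shE over_z over_at over_off.
rewrite /projection_diagram; congr Diagram.
  rewrite -shE D1E.
  apply/seteqP; split=> v /= [v0 [x vx]]; split=> //; exists x.
    by rewrite FL; apply: same_point_trans vx _; exact: same_point_scaler.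
  apply: same_point_trans vx _; rewrite FL.
  by apply: same_point_sym; exact: same_point_scaler.
apply/funext => v; apply/funext => w'; apply/propext.
rewrite -[X in _ <-> X]/(goes_over (projection_diagram F L h) v w') overF.
(* At the crossing, [v] for [F] corresponds to -v for [D1], which is under at -v for [D2], that is,
   over at [v]. *)
have [vz|vz] := pselect (same_point v z).
  rewrite asboolT // scaleN1r over_at /goes_under /= ?opprK //.
  apply: same_point_trans vz; rewrite -[X in same_point X](scaleN1r v).
  apply/same_point_sym/same_point_scaler.
  by rewrite oppr_eq0 oner_neq0.
by rewrite asboolF // scale1r over_off.
Qed.
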